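(* The polynomial dialgebra $Di[X]$ is Noetherian if $X$ is a finite set.
   Context: Fix a field $\mathbf{k}$. Let $X$ be a totally ordered set and $\lfloor X^+\rfloor$ the free commutative semigroup without unit on $X$ (elements $\lfloor u\rfloor$, length $|u|$). Let $\lfloor X^+\rfloor_1=\{\lfloor u\rfloor_1\mid\lfloor u\rfloor\in\lfloor X^+\rfloor\}$ and $\lfloor XX\rfloor_2=\{\lfloor v\rfloor_2\mid\lfloor v\rfloor\in\lfloor X^+\rfloor,|v|=2\}$ (formal symbols); $x\in X$ is identified with $\lfloor x\rfloor_1$. The polynomial dialgebra (free commutative dialgebra generated by $X$) $Di[X]$ is the $\mathbf{k}$-space with basis $\lfloor X^+\rfloor_1\cup\lfloor XX\rfloor_2$ and bilinear operations $\vdash,\dashv$ given by: for $x,x'\in X$, $x\dashv x'=\lfloor xx'\rfloor_1$, $x\vdash x'=\lfloor xx'\rfloor_2$; and if $|uv|>2$, $\lfloor u\rfloor_p\vdash\lfloor v\rfloor_q=\lfloor u\rfloor_p\dashv\lfloor v\rfloor_q=\lfloor uv\rfloor_1$. Both operations are associative and commutative. An ideal of $Di[X]$ is a $\mathbf{k}$-subspace $I$ such that $f\vdash g,\ f\dashv g,\ g\vdash f,\ g\dashv f\in I$ for all $f\in Di[X]$, $g\in I$. Noetherian means that every ascending chain of ideals stabilizes. *)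

(* Defs.v *)
From HB Require Import structures.
From mathcomp Require Import all_boot all_order all_algebra.
From mathcomp Require Import finmap monalg.

Set Implicit Arguments.
Unset Strict Implicit.
Unset Printing Implicit Defensive.

Import GRing.Theory.
Local Open Scope ring_scope.

Section Words.
Variable X : choiceType.

(* The free commutative semigroup without unit on X, i.e. the free
   commutative monoid {cmonom X} deprived of its unit; mdeg is the length. *)
Definition csword := {u : {cmonom X} | (0 < mdeg u)%N}.

Definition cslen (u : csword) : nat := mdeg (val u).

Lemma csword_mul_subproof (u v : csword) : (0 < mdeg (mmul (val u) (val v)))%N.
Proof. by rewrite mdegM addn_gt0 (valP u). Qed.

Definition csword_mul (u v : csword) : csword :=
  exist _ (mmul (val u) (val v)) (csword_mul_subproof u v).

Lemma csword_gen_subproof (x : X) : (0 < mdeg (ucm x))%N.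
Proof. by rewrite mdegU. Qed.

Definition csword_gen (x : X) : csword := exist _ (ucm x) (csword_gen_subproof x).

Definition csword2 := {v : csword | cslen v == 2%N}.

(* Basis of Di[X]: inl u is the symbol |_u_|_1, and inr v is |_v_|_2, which
   only exists for words v of length 2. *)
Definition dibasis := (csword + csword2)%type.

Definition diword (b : dibasis) : csword :=
  match b with inl u => u | inr v => val v end.

Definition digen (x : X) : dibasis := inl (csword_gen x).

(* Products of basis symbols.  A product of two symbols has length at least 2,
   with equality only if both are generators: then ⊣ gives |_xx'_|_1 and
   ⊢ gives |_xx'_|_2.  In all other cases both give |_uv_|_1. *)
Definition dibasis_l (b c : dibasis) : dibasis :=
  inl (csword_mul (diword b) (diword c)).

Definition dibasis_r (b c : dibasis) : dibasis :=
  let w := csword_mul (diword b) (diword c) in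
  if insub w is Some v then inr (v : csword2) else inl w.

End Words.

Notation "{ 'Di' k [ X ] }" := {malg k[dibasis X]}
  (at level 0, k, X at level 2, format "{ 'Di'  k [ X ] }") : type_scope.

Section Dialgebra.
Variables (X : choiceType) (k : fieldType).
Implicit Types (f g h : {Di k[X]}) (op : dibasis X -> dibasis X -> dibasis X).

(* The bilinear extension to Di[X] of an operation on its basis. *)
Definition diextend op f g : {Di k[X]} :=
  \sum_(b <- msupp f) \sum_(c <- msupp g) << f@_b * g@_c *g op b c >>.

Definition dil := diextend (@dibasis_l X).
Definition dir := diextend (@dibasis_r X).

End Dialgebra.

Notation "f '⊣' g" := (dil f g) (at level 40, left associativity) : ring_scope.
Notation "f '⊢' g" := (dir f g) (at level 40, left associativity) : ring_scope.

Section Facts.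
Variables (X : choiceType) (k : fieldType).
Implicit Types (f g h : {Di k[X]}) (op : dibasis X -> dibasis X -> dibasis X).

Lemma diextendEw op (d e : {fset dibasis X}) f g :
  (msupp f `<=` d)%fset -> (msupp g `<=` e)%fset ->
  diextend op f g = \sum_(b <- d) \sum_(c <- e) << f@_b * g@_c *g op b c >>.
Proof.
move=> fd ge; rewrite /diextend (big_fset_incl _ fd) /=; last first.
  move=> b _ /mcoeff_outdom fb; rewrite big1 // => c _.
  by rewrite fb mul0r monalgU0.
apply: eq_bigr => b _; rewrite (big_fset_incl _ ge) // => c _.
by move=> /mcoeff_outdom gc; rewrite gc mulr0 monalgU0.
Qed.

Lemma diextendU op (a b : k) (u v : dibasis X) :
  diextend op << a *g u >> << b *g v >> = << a * b *g op u v >>.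
Proof.
rewrite (@diextendEw op [fset u]%fset [fset v]%fset) ?msuppU_le //.
by rewrite !big_seq_fset1 !mcoeffUU.
Qed.

Lemma mkmalgUZ (a b : k) (u : dibasis X) :
  << a * b *g u >> = a *: << b *g u >> :> {Di k[X]}.
Proof. by apply/malgP => c; rewrite mcoeffZ !mcoeffU mulrnAr. Qed.

Lemma diextend_linearl op g : linear (fun f => diextend op f g).
Proof.
move=> a f h; set d := (msupp f `|` msupp h `|` msupp (a *: f + h))%fset.
have sub3 : [/\ msupp f `<=` d, msupp h `<=` d & msupp (a *: f + h) `<=` d]%fset.
  split; rewrite /d; apply/fsubsetP => b bs; rewrite !inE bs ?orbT //.
have [fd hd fhd] := sub3.
have gg := fsubset_refl (msupp g).
rewrite (diextendEw op fd gg) (diextendEw op hd gg) (diextendEw op fhd gg).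
rewrite scaler_sumr -big_split; apply: eq_bigr => b _ /=.
rewrite scaler_sumr -big_split; apply: eq_bigr => c _ /=.
by rewrite -mkmalgUZ -monalgUD mcoeffD mcoeffZ mulrDl mulrA.
Qed.

Lemma diextend_linearr op f : linear (diextend op f).
Proof.
move=> a g h; set d := (msupp g `|` msupp h `|` msupp (a *: g + h))%fset.
have sub3 : [/\ msupp g `<=` d, msupp h `<=` d & msupp (a *: g + h) `<=` d]%fset.
  split; rewrite /d; apply/fsubsetP => b bs; rewrite !inE bs ?orbT //.
have [gd hd ghd] := sub3.
have ff := fsubset_refl (msupp f).
rewrite (diextendEw op ff gd) (diextendEw op ff hd) (diextendEw op ff ghd).
rewrite scaler_sumr -big_split; apply: eq_bigr => b _ /=.
rewrite scaler_sumr -big_split; apply: eq_bigr => c _ /=.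
by rewrite -mkmalgUZ -monalgUD mcoeffD mcoeffZ mulrDr mulrCA.
Qed.

Lemma dil_gen (x y : X) :
  << digen x >> ⊣ << digen y >>
  = << inl (csword_mul (csword_gen x) (csword_gen y)) >> :> {Di k[X]}.
Proof. by rewrite /dil diextendU mulr1. Qed.

Lemma dir_gen (x y : X) :
  exists2 v : csword2 X, val v = csword_mul (csword_gen x) (csword_gen y)
    & << digen x >> ⊢ << digen y >> = << inr v >> :> {Di k[X]}.
Proof.
have len2 : cslen (csword_mul (csword_gen x) (csword_gen y)) == 2%N.
  by rewrite /cslen /= mdegM !mdegU.
exists (exist (fun v : csword X => cslen v == 2%N) _ len2) => //.
by rewrite /dir diextendU mulr1 /dibasis_r /= insubT.
Qed.

Lemma dilr_long (b c : dibasis X) :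
  let w := csword_mul (diword b) (diword c) in (2 < cslen w)%N ->
  << b >> ⊣ << c >> = << inl w >> :> {Di k[X]} /\
  << b >> ⊢ << c >> = << inl w >> :> {Di k[X]}.
Proof.
move=> w w3; rewrite /dil /dir !diextendU mulr1; split=> //.
by rewrite /dibasis_r -/w insubF // gtn_eqF.
Qed.

End Facts.

Section Ideals.
Variables (X : choiceType) (k : fieldType).

Record di_ideal (I : {Di k[X]} -> Prop) : Prop := {
  di_ideal0 : I 0;
  di_idealD : forall f g, I f -> I g -> I (f + g);
  di_idealZ : forall (a : k) f, I f -> I (a *: f);
  di_idealM : forall f g, I g ->
    [/\ I (f ⊢ g), I (f ⊣ g), I (g ⊢ f) & I (g ⊣ f)]
}.

Definition di_noetherian : Prop :=
  forall I : nat -> {Di k[X]} -> Prop,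
    (forall n, di_ideal (I n)) ->
    (forall n f, I n f -> I n.+1 f) ->
    exists N : nat, forall n, (N <= n)%N -> forall f, I n f <-> I N f.

End Ideals.

(* Main.v *)
Require Import Defs.
From mathcomp Require Import all_boot all_order all_algebra.
From mathcomp Require Import -(notations) mpoly.
From mathcomp Require Import finmap monalg.
From Stdlib Require Import ClassicalEpsilon.

(** The proof is a Groebner basis argument: it follows the leading basis
elements of the members of an ideal.  The basis of the polynomial dialgebra is
well-ordered by putting every symbol [inr v] above every symbol [inl u], and
by comparing symbols of the same kind through a monomial order on their words.

With this choice, an element whose leading symbol is [inl u] has no [inr]
component, so multiplying it by a word [y] moves its leading symbol to
[inl (u y)] ([lead_dil]).  (If the two kinds of symbols were interleaved, the
leading term could cancel: the element [inl v - inr v] is annihilated by every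
product.)  Leading symbols [inr v] are not propagated at all, but their words
have length 2, so that divisibility between two of them is equality.  Hence the
set of leading symbols of an ideal is closed upwards for divisibility of words
among symbols of the same kind ([lead_up]).

Divisibility is a well-quasi-order by Dickson's lemma ([dickson]), and
two nested subspaces with the same leading symbols are equal
([subspace_eq_of_lead]).  A chain of ideals that does not stabilize would thus
gain new leading symbols infinitely often; two of these would be comparable,
the earlier one dividing the later one, and the later one would not be new. *)

Set Implicit Arguments.
Unset Strict Implicit.
Unset Printing Implicit Defensive.

Import Order.TTheory GRing.Theory.
Local Open Scope ring_scope.

(** * Subsequences and Dickson's lemma *)

(** The next index is repeatedly chosen to minimize [g] on a tail of the
sequence; later indices lie in that tail, so [g] cannot decrease. *)
Lemma nondecreasing_subsequence (g : nat -> nat) :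
  exists phi : nat -> nat,
    {homo phi : i j / (i < j)%N} /\ {homo g \o phi : i j / (i <= j)%N}.
Proof.
have tail_min m : exists n, (m <= n)%N /\ forall j, (m <= j)%N -> (g n <= g j)%N.
  suff: forall v n, (m <= n)%N -> (g n <= v)%N ->
    exists n', (m <= n')%N /\ forall j, (m <= j)%N -> (g n' <= g j)%N.
    by move=> /(_ (g m) m); apply.
  elim=> [|v IHv] n mn gn.
    by exists n; split=> // j _; rewrite (leq_trans gn).
  have [[j [mj gj]]|no] := classic (exists j, (m <= j)%N /\ (g j <= v)%N).
    exact: IHv mj gj.
  exists n; split=> // j mj; rewrite (leq_trans gn) // ltnNge.
  by apply/negP => gj; apply: no; exists j.
pose p m := proj1_sig (constructive_indefinite_description _ (tail_min m)).
have pP m : (m <= p m)%N /\ forall j, (m <= j)%N -> (g (p m) <= g j)%N.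
  exact: (proj2_sig (constructive_indefinite_description _ (tail_min m))).
pose phi := fix phi k := if k is k'.+1 then p (phi k').+1 else p 0%N.
have phi_lt k : (phi k < phi k.+1)%N by have [] := pP (phi k).+1.
exists phi; split.
  by apply: homo_ltn => //; apply: ltn_trans.
apply: homo_leq => //; first exact: leq_trans.
case=> [|k] /=; first by apply: (pP 0%N).2.
apply: (pP _).2; exact: leq_trans (phi_lt k) (ltnW (phi_lt k.+1)).
Qed.

(** Extracting a nondecreasing subsequence for one coordinate preserves
monotonicity of the coordinates already treated, and there are finitely many
of them. *)
Lemma dickson (I : finType) (T : Type) (g : I -> T -> nat) (s : nat -> T) :
  exists i j, (i < j)%N /\ forall x, (g x (s i) <= g x (s j))%N.
Proof.
suff [phi [phi_lt mono]] : exists phi : nat -> nat,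
    {homo phi : i j / (i < j)%N} /\
    forall x, x \in enum I ->
      {homo (fun i => g x (s (phi i))) : i j / (i <= j)%N}.
  exists (phi 0%N), (phi 1%N); split; first exact: phi_lt.
  by move=> x; apply: mono; rewrite ?mem_enum.
elim: (enum I) => [|x r [phi [phi_lt mono]]]; first by exists id; split.
have [psi [psi_lt psi_mono]] :=
  nondecreasing_subsequence (fun i => g x (s (phi i))).
exists (phi \o psi); split=> [i j ij|y]; first exact/phi_lt/psi_lt.
rewrite inE => /predU1P[-> //|yr] i j ij.
exact: (mono _ yr _ _ (ltnW_homo psi_lt ij)).
Qed.

(** * Leading basis elements *)

Section Leading.
Variables (k : fieldType) (T : choiceType).
Variables (d : Order.disp_t) (K : orderType d) (key : T -> K).
Hypothesis key_inj : injective key.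
Hypothesis key_wf : well_founded (fun x y : K => x < y)%O.
Implicit Types (f g : {malg k[T]}) (b : T).

(** The order on the basis is given through an injection [key] into a totally
ordered type, which lets any well-ordered type serve as a rank. *)
Definition is_lead f b :=
  b \in msupp f /\ forall c, c \in msupp f -> (key c <= key b)%O.

Lemma lead_ex f : f != 0 -> exists b, is_lead f b.
Proof.
move=> fn0; have /fset0Pn[b0 b0f] : msupp f != fset0.
  apply: contraNneq fn0 => f0; apply/eqP/malgP => c.
  by rewrite mcoeff0 mcoeff_outdom // f0.
case: (@arg_maxP _ K _ [` b0f]%fset xpredT (fun b : msupp f => key (val b))) => // b _ bmax.
by exists (val b); split=> [|c cf]; [exact: valP | exact: (bmax [` cf]%fset isT)].
Qed.

(** The relabelling [h] need not be injective: it suffices that no other element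
of the support reaches the image of the leading one, which excludes any
cancellation there. *)
Lemma lead_relabel f b (h : T -> T) :
    is_lead f b ->
    (forall c, c \in msupp f -> c != b -> (key (h c) < key (h b))%O) ->
  is_lead (\sum_(c <- msupp f) << f@_c *g h c >>) (h b).
Proof.
move=> [fb _] hlt; split.
  rewrite -mcoeff_neq0 raddf_sum /= (big_fsetD1 _ fb) /= mcoeffUU big_seq big1.
    by rewrite addr0 mcoeff_neq0.
  move=> c; rewrite !inE => /andP[cb /hlt/(_ cb)]; rewrite mcoeffU.
  by case: eqP => // ->; rewrite ltxx.
move=> e; rewrite -mcoeff_neq0 raddf_sum /= => en0.
have [c fc <-] : exists2 c, c \in msupp f & h c = e.
  apply: NNPP => no; case/negP: en0; rewrite big_seq big1 // => c fc.
  by rewrite mcoeffU; case: eqP => // hc; case: no; exists c.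
by have [->//|cb] := eqVneq c b; exact/ltW/hlt.
Qed.

(** Well-founded induction on the leading element: subtracting from [f] in [J]
a multiple of an element of [I] with the same leading element gives an element
of [J] that is zero or has a smaller leading element. *)
Lemma subspace_eq_of_lead (I J : {malg k[T]} -> Prop) :
    (forall f g, I f -> I g -> I (f + g)) ->
    (forall a f, I f -> I (a *: f)) -> I 0 ->
    (forall f g, J f -> J g -> J (f + g)) ->
    (forall a f, J f -> J (a *: f)) ->
    (forall f, I f -> J f) ->
    (forall f b, J f -> is_lead f b -> exists2 g, I g & is_lead g b) ->
  forall f, J f -> I f.
Proof.
move=> ID IZ I0 JD JZ IJ leadIJ.
suff claim x : forall f b, key b = x -> J f -> is_lead f b -> I f.
  move=> f Jf; have [->//|/lead_ex[b fb]] := eqVneq f 0.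
  exact: claim (erefl _) Jf fb.
elim/(well_founded_ind key_wf): x => x IH f b bx Jf fb.
have [g Ig [gb gmax]] := leadIJ _ _ Jf fb.
case: fb => fb fmax.
have gb0 : g@_b != 0 by rewrite mcoeff_neq0.
pose a := f@_b / g@_b; pose h := f - a *: g.
have -> : f = h + a *: g by rewrite subrK.
apply: ID; last exact: IZ.
have Jh : J h by apply: JD => //; rewrite -scaleNr; apply/JZ/IJ.
have [h0|/lead_ex[c hc]] := eqVneq h 0; first by rewrite h0.
have hb : h@_b = 0 by rewrite mcoeffB mcoeffZ divfK // subrr.
have [ch _] := hc.
apply: IH (erefl (key c)) Jh hc; rewrite -bx lt_neqAle.
apply/andP; split.
  by apply: contraTneq ch => /key_inj->; rewrite -mcoeff_neq0 hb eqxx.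
have /fsubsetP/(_ _ ch) := msuppB_le f (a *: g).
rewrite inE => /orP[/fmax //|cg]; apply: gmax.
exact: (fsubsetP (msuppZ_le _ _)) cg.
Qed.
End Leading.

(** * Leading symbols of ideals of the dialgebra *)

Section Basis.
Variables (k : fieldType) (X : finType).
Implicit Types (u v w : {cmonom X}) (b c : dibasis X) (f g : {Di k[X]}).

Definition exponents u : multinom #|X| := Multinom [tuple u (enum_val i) | i < #|X|].

Lemma exponents_inj : injective exponents.
Proof.
move=> u v /mnmP uv; apply/eqP/cmP => x.
by have := uv (enum_rank x); rewrite !mnmE enum_rankK.
Qed.

Lemma exponentsM u v : exponents (mmul u v) = mnm_add (exponents u) (exponents v).
Proof. by apply/mnmP => i; rewrite mnmDE !mnmE cmM. Qed.

Definition is_inr b := if b is inr _ then true else false.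

(** Since [false] is less than [true], every [inr] symbol lies above every
[inl] symbol. *)
Definition basis_key b : bool *l (multinom #|X|) :=
  (is_inr b, exponents (val (diword b))).

Lemma basis_key_inj : injective basis_key.
Proof.
case=> u [] v // /(congr1 snd) /exponents_inj/val_inj uv; congr (_ _) => //.
exact: val_inj.
Qed.

Lemma basis_key_wf :
  well_founded (fun x y : bool *l (multinom #|X|) => x < y)%O.
Proof.
pose lt := (fun x y : bool *l (multinom #|X|) => x < y)%O.
have lt_true e m n : lt (e, m) (true, n) -> e = false \/ e = true /\ (m < n)%O.
  by rewrite /lt ltEprodlexi => /andP[_] /=; case: e; [right | left].
have lt_false e m n : lt (e, m) (false, n) -> e = false /\ (m < n)%O.
  by rewrite /lt ltEprodlexi => /andP[] /=; case: e.
have acc_false m : Acc lt (false, m).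
  move: m; apply: (@ltmwf #|X|) => m IH; constructor=> -[e m'].
  by move=> /lt_false[-> /IH].
case=> -[] m; last exact: acc_false.
move: m; apply: (@ltmwf #|X|) => m IH; constructor=> -[e m'].
by move=> /lt_true[->|[-> /IH //]]; apply: acc_false.
Qed.

Lemma dil_wordE f (y : csword X) :
  f ⊣ << inl y >> =
  \sum_(b <- msupp f) << f@_b *g inl (csword_mul (diword b) y) >>.
Proof.
rewrite /dil (diextendEw _ (fsubset_refl _) (msuppU_le (k := inl y))).
by apply: eq_bigr => b _; rewrite big_seq_fset1 mcoeffUU mulr1.
Qed.

(** As [inr] symbols are the largest, [f] is supported on [inl] symbols, where
multiplication by [y] is strictly monotone because the order on exponents is
compatible with addition. *)
Lemma lead_dil f (u y : csword X) :
  is_lead basis_key f (inl u) ->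
  is_lead basis_key (f ⊣ << inl y >>) (inl (csword_mul u y)).
Proof.
move=> fu; have [_ fmax] := fu; rewrite dil_wordE.
apply: (lead_relabel (h := fun b => inl (csword_mul (diword b) y))) fu _.
move=> b /fmax; rewrite le_eqVlt => /predU1P[/basis_key_inj->|].
  by rewrite eqxx.
rewrite ltEprodlexi; case: b => v //= vu _.
by rewrite ltEprodlexi /= !exponentsM ltmc_add2l.
Qed.

Lemma cmonom_dvd u w : (forall x, u x <= w x)%N -> exists y, w = mmul u y.
Proof.
move=> uw; exists (divcm w u); apply/eqP/cmP => x.
by rewrite cmM divcmE subnKC.
Qed.

(** The cofactor [y] is either trivial, and then [b = c], or a genuine word by
which [f] can be multiplied.  For [inr] symbols only the first case occurs,
since both words have length 2. *)
Lemma lead_up (I : {Di k[X]} -> Prop) b c :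
    di_ideal I -> is_inr b = is_inr c ->
    (forall x, val (diword b) x <= val (diword c) x)%N ->
    (exists2 f, I f & is_lead basis_key f b) ->
  exists2 f, I f & is_lead basis_key f c.
Proof.
move=> idI bc /cmonom_dvd[y cby] [f If fb].
have [y0|yn0] := posnP (mdeg y).
  exists f => //; suff <- : b = c by [].
  apply: basis_key_inj; rewrite /basis_key bc cby.
  by rewrite (mdeg_eq0I y0) mulm1.
case: b c bc cby fb => [u|u] [v|v] // _ /= cby fb; last first.
  have len2 (w : csword2 X) : mdeg (val (val w)) = 2%N by apply/eqP/(valP w).
  have := etrans (congr1 mdeg (esym cby)) (len2 v); rewrite mdegM (len2 u) -[RHS]addn0 => /addnI y0.
  by rewrite y0 in yn0.
exists (f ⊣ << inl (exist _ y yn0) >>).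
  by have [] := di_idealM idI << inl (exist _ y yn0) >> If.
suff -> : v = csword_mul u (exist _ y yn0) by exact: lead_dil.
exact: val_inj.
Qed.

End Basis.

(** * Noetherianity *)

Theorem corollary24 (k : fieldType) (d : Order.disp_t) (X : finOrderType d) :
  di_noetherian X k.
Proof.
move=> I idI Isub.
have Imono m n f : (m <= n)%N -> I m f -> I n f.
  move=> /subnK<-; elim: (n - m)%N => // j IH Im; exact/Isub/IH.
pose L n b := exists2 f, I n f & is_lead (@basis_key X) f b.
apply: NNPP => noN.
have new N : exists nb : nat * dibasis X,
    [/\ (N <= nb.1)%N, L nb.1 nb.2 & ~ L N nb.2].
  apply: NNPP => no; apply: noN; exists N => n Nn f; split; last exact: Imono.
  have [I0 ID IZ _] := idI N; have [_ JD JZ _] := idI n.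
  apply: (subspace_eq_of_lead (@basis_key_inj X) (@basis_key_wf X)) => //.
    by move=> g; apply: Imono.
  move=> g b Ing gb; apply: NNPP => noL; apply: no; exists (n, b); split=> //.
  by exists g.
(* [nx N] is a later stage together with a leading symbol gained there. *)
pose nx N := proj1_sig (constructive_indefinite_description _ (new N)).
have nxP N : [/\ (N <= (nx N).1)%N, L (nx N).1 (nx N).2 & ~ L N (nx N).2].
  exact: (proj2_sig (constructive_indefinite_description _ (new N))).
pose stage i := iter i (fun N => (nx N).1) 0%N.
(* The two indicator features of the kind of a symbol turn monotonicity into
   equality of kinds. *)
pose feature (t : X + bool) b : nat :=
  match t with inl x => val (diword b) x | inr e => (is_inr b == e) end.
have [i [j [ij le_ij]]] := dickson feature (fun i => (nx (stage i)).2).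
have [_ Li _] := nxP (stage i); have [_ _] := nxP (stage j); apply.
have Lj : L (stage j) (nx (stage i)).2.
  have le_stage : (stage i.+1 <= stage j)%N.
    apply: (homo_leq (r := leq)) ij => // [|n]; first exact: leq_trans.
    by have [] := nxP (stage n).
  by have [f If fb] := Li; exists f => //; apply: Imono le_stage If.
apply: lead_up Lj => //; last by move=> x; apply: (le_ij (inl x)).
have := le_ij (inr (is_inr (nx (stage i)).2)); rewrite /= eqxx.
by case: eqP.
Qed.
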